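(* Let $d\ge 2$ be an integer, $V=\{1,\dots,d\}$, and let $a,b\in\mathbb{R}^V$ satisfy $0<b_i<a_i$ for all $i\in V$. Let $\pi_{ii}=1$ for $i\in V$ and $\pi_{ij}=a_j/b_i$ for $i,j\in V$, $i\ne j$. Let $K_d^+$ be the dual cone of the solvency cone $K_d$ induced by $\Pi=(\pi_{ij})$. Then there is a one-to-one map between the set of all bipartitions $(P,N)$ of $V$ and the set of all extreme directions $y$ of $K_d^+$, where the extreme direction $y$ corresponding to $(P,N)$ can be expressed as $y_i=b_i$ for $i\in P$ and $y_j=a_j$ for $j\in N$. In particular, $K_d^+$ has exactly $2^d-2$ extreme directions.
   Context: The solvency cone is $K_d=\{\sum_{(i,j)\in V\times V} z_{ij}(\pi_{ij}e^i-e^j) : z_{ij}\ge 0 \text{ for all } i,j\}$, where $e^i$ is the $i$-th unit vector of $\mathbb{R}^d$, and $K_d^+=\{y\in\mathbb{R}^d : x^\top y\ge 0 \text{ for all } x\in K_d\}$. A bipartition $(P,N)$ of $V$ is an ordered pair of nonempty disjoint sets with $P\cup N=V$. A vector $y\in K\setminus\{0\}$ is an extreme direction of a polyhedral convex cone $K$ if it belongs to a $1$-dimensional face of $K$; extreme directions that are positive multiples of each other are considered identical (and counted once). ''One-to-one map between'' two sets means a bijection. *)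

(* Defs.v *)
From HB Require Import structures.
From mathcomp Require Export all_boot all_order all_algebra.
From mathcomp Require Export classical_sets functions cardinality reals convex.

Set Implicit Arguments.
Unset Strict Implicit.
Unset Printing Implicit Defensive.

Import Order.TTheory GRing.Theory Num.Theory.

Local Open Scope classical_set_scope.
Local Open Scope ring_scope.

Definition transaction_mx (R : realType) (d : nat) (a b : 'cV[R]_d) : 'M[R]_d :=
  \matrix_(i, j) if i == j then 1 else a j 0 / b i 0.

Definition solvency_cone (R : realType) (d : nat) (Pi : 'M[R]_d) :
    set 'cV[R]_d :=
  [set x | exists2 z : 'M[R]_d, (forall i j, 0 <= z i j) &
     x = \sum_(i < d) \sum_(j < d)
           z i j *: (Pi i j *: delta_mx i 0 - delta_mx j 0)].

Definition dual_cone (R : realType) (d : nat) (K : set 'cV[R]_d) :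
    set 'cV[R]_d :=
  [set y | forall x, K x -> 0 <= (x^T *m y) 0 0].

Definition affine_set (R : realType) (d : nat) (A : set 'cV[R]_d) : Prop :=
  forall (x y : 'cV[R]_d) (t : R), A x -> A y -> A (t *: x + (1 - t) *: y).

Definition affine_hull (R : realType) (d : nat) (A : set 'cV[R]_d) :
    set 'cV[R]_d :=
  smallest (@affine_set R d) A.

(* The base point [p] lies in the affine hull, so the empty set has no
   dimension in this sense. *)
Definition has_dim (R : realType) (d : nat) (A : set 'cV[R]_d) (k : nat) :
    Prop :=
  exists (p : 'cV[R]_d) (U : {vspace 'cV[R]_d}),
    \dim U = k /\ affine_hull A = [set x | x - p \in U].

Definition face (R : realType) (d : nat) (K F : set 'cV[R]_d) : Prop :=
  [/\ F `<=` K, convex_set F &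
      forall (x y : 'cV[R]_d) (t : R), K x -> K y -> 0 < t < 1 ->
        F (t *: x + (1 - t) *: y) -> F x /\ F y].

Definition extreme_direction (R : realType) (d : nat) (K : set 'cV[R]_d) :
    set 'cV[R]_d :=
  [set y | [/\ K y, y != 0 & exists F, [/\ face K F, has_dim F 1 & F y]]].

(* Extreme directions that are positive multiples of each other are
   identified: an element of [extreme_directions K] is an equivalence class of
   vectors, represented as a set. *)
Definition extreme_directions (R : realType) (d : nat) (K : set 'cV[R]_d) :
    set (set 'cV[R]_d) :=
  [set [set y' | extreme_direction K y' /\ exists2 c : R, 0 < c & y' = c *: y]
     | y in extreme_direction K].

Definition bipartitions (d : nat) : set ({set 'I_d} * {set 'I_d}) :=
  [set PN | [/\ PN.1 != finset.set0, PN.2 != finset.set0,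
                (PN.1 :&: PN.2)%SET = finset.set0 &
                (PN.1 :|: PN.2)%SET = finset.setT]].

(* Main.v *)
Require Import Defs.
From mathcomp Require Import interval_inference lra.
Import Order.TTheory GRing.Theory Num.Theory.

(** Let [K] be the dual of the solvency cone.  Testing a vector [y] against the
    generators of the solvency cone turns membership in [K] into the
    inequalities [y_j / a_j <= y_i / b_i] for [i != j].  Two such inequalities
    in opposite directions force [y >= 0], which supplies the case [i = j], so
    some [l >= 0] separates all the [y_j / a_j] from all the [y_i / b_i]: this
    says [l * b <= y <= l * a] coordinatewise.  Hence [K] is the cone spanned by
    the box [[b, a]] ([dual_transaction_coneP]).

    A nonzero [y] in a pointed cone is an extreme direction exactly when every
    decomposition [y = u + v] inside the cone has [u] proportional to [y]
    ([extreme_direction_split], [extreme_directionI]).  This is tested on [K]: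
    - let [y] be a vertex of the box with some coordinate [b_p] and some
      coordinate [a_q].  If [y = u + v] with [u], [v] in the boxes of scale [lu]
      and [lv], then [y] lies in the box of scale [lu + lv]; the coordinates
      [p] and [q] force [lu + lv = 1], and then [u = lu *: y] coordinate by
      coordinate ([box_vertex_split]);
    - conversely, let [y] be extreme and in the box of scale [l].  No coordinate
      of [y] is strictly between [l * b_k] and [l * a_k], for otherwise
      [y] is the midpoint of [y + e] and [y - e], with [e] a small multiple of
      the [k]-th unit vector ([extreme_direction_coord]).  This holds for every
      admissible scale [l], which excludes the vertices [l *: a] and [l *: b]:
      each of them lies inside the box of a slightly larger, respectively
      smaller, scale.

    So the extreme directions are the positive multiples of the vertices of the
    box other than [a] and [b] ([extreme_direction_vertexP]).  Distinct ones
    among these vertices are not proportional, and they correspond to the sets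
    [P] other than the empty and the full set, of which there are [2 ^ d - 2]. *)

Set Implicit Arguments.
Unset Strict Implicit.
Unset Printing Implicit Defensive.
Local Open Scope classical_set_scope.
Local Open Scope ring_scope.

(** * Extreme directions of pointed cones *)

Definition pointed_cone (R : realType) (d : nat) (K : set 'cV[R]_d) : Prop :=
  [/\ forall (c : R) x, 0 <= c -> K x -> K (c *: x),
      forall x x', K x -> K x' -> K (x + x') &
      forall x, K x -> K (- x) -> x = 0].

(** The midpoints [y = (2u + 2v)/2] and [y = (0 + 2y)/2] put [2u] and [0] in the
    face of dimension 1 through [y].  Since it contains [0] and [y], its affine
    hull is the line spanned by [y]. *)
Lemma extreme_direction_split (R : realType) (d : nat) (K : set 'cV[R]_d)
    (y u v : 'cV[R]_d) :
  pointed_cone K -> extreme_direction K y -> K u -> K v -> y = u + v ->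
  exists c : R, u = c *: y.
Proof.
move=> [KZ _ _] [Ky y0 [F [[_ _ Fext] [p [U [dimU hullF]]] Fy]]] Ku Kv yuv.
have FU x : F x -> x - p \in U.
  move=> Fx; suff : affine_hull F x by rewrite hullF.
  by move=> A [_]; exact.
have F_double w w' : K w -> K w' -> y = w + w' -> F (2 *: w).
  move=> Kw Kw' yE; have [] // := Fext (2 *: w) (2 *: w') 2^-1.
  - exact: KZ.
  - exact: KZ.
  - by lra.
  - have -> : 1 - 2^-1 = 2^-1 :> R by lra.
    by rewrite !scalerA mulVf ?pnatr_eq0// !scale1r -yE.
have K0 : K 0 by rewrite -(scale0r y); exact: KZ.
have pU : p \in U.
  have /FU : F (2 *: 0) by apply: (F_double 0 y) => //; rewrite add0r.
  by rewrite scaler0 sub0r memvN.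
have F_U x : F x -> x \in U.
  by move=> /FU xpU; rewrite -(subrK p x) memvD.
have yU : y \in U := F_U y Fy.
have UE : U = <[y]>%VS.
  by apply/eqP; rewrite eq_sym eqEdim -memvE yU dim_vline y0 dimU.
have /F_U : F (2 *: u) by exact: (F_double u v).
rewrite UE => /vlineP[k kE]; exists (2^-1 * k).
by rewrite -scalerA -kE scalerA mulVf ?scale1r// pnatr_eq0.
Qed.

(** The face is the intersection of [K] with the line spanned by [y]. *)
Lemma extreme_directionI (R : realType) (d : nat) (K : set 'cV[R]_d)
    (y : 'cV[R]_d) :
  pointed_cone K -> K y -> y != 0 ->
  (forall u v, K u -> K v -> y = u + v -> exists c : R, u = c *: y) ->
  extreme_direction K y.
Proof.
move=> [KZ KD Kpt] Ky y0 ysplit; split => //.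
have K0 : K 0 by rewrite -(scale0r y); exact: KZ.
exists [set x | K x /\ exists c : R, x = c *: y]; split; last first.
- by split=> //; exists 1; rewrite scale1r.
- exists 0, <[y]>%VS; split; first by rewrite dim_vline y0.
  apply/seteqP; split => x /=.
    move=> /(_ [set x | x \in <[y]>%VS]) /=; rewrite subr0; apply; split.
      by move=> u v t /= uy vy; rewrite memvD// memvZ.
    by move=> u /= [_ [c ->]]; rewrite memvZ// memv_line.
  (* a line is the affine hull of any two of its points, here [y] and [0] *)
  rewrite subr0 => /vlineP[c ->] A [affA subA].
  have -> : c *: y = c *: y + (1 - c) *: 0 by rewrite scaler0 addr0.
  apply: affA; apply: subA => /=; split => //.
    by exists 1; rewrite scale1r.
  by exists 0; rewrite scale0r.
split.
- by move=> x [].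
- move=> x x' t; rewrite !inE => -[Kx [c cE]] [Kx' [c' c'E]].
  split.
    apply: KD; apply: KZ => //.
    by rewrite subr_ge0.
  exists (t%:num * c + (1 - t%:num) * c').
  by rewrite scalerDl -!scalerA -cE -c'E.
move=> x x' t Kx Kx' /andP[t0 t1] [_ [c cE]].
have summandE (s : R) (w w' : 'cV[R]_d) : 0 < s -> K w -> K w' ->
    s *: w + w' = c *: y -> exists k : R, w = k *: y.
  move=> s0 Kw Kw' E; have Ksw : K (s *: w) by apply: KZ => //; exact: ltW.
  have [cle|c0] := leP c 0.
    (* [- (s *: w) = w' - c *: y] is in [K] too, so [w = 0] *)
    have /eqP : s *: w = 0.
      apply: Kpt => //; have -> : - (s *: w) = w' + (- c) *: y.
        by rewrite scaleNr -E opprD addrCA subrr addr0.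
      by apply: KD => //; apply: KZ => //; rewrite oppr_ge0.
    by rewrite scaler_eq0 gt_eqF//= => /eqP ->; exists 0; rewrite scale0r.
  have civ0 : 0 <= c^-1 by rewrite invr_ge0 ltW.
  have [k kE] : exists k : R, c^-1 *: (s *: w) = k *: y.
    apply: (ysplit _ (c^-1 *: w')); [exact: KZ|exact: KZ|].
    by rewrite -scalerDr E scalerA mulVf ?scale1r// gt_eqF.
  exists (s^-1 * (c * k)); rewrite -!scalerA -kE.
  rewrite (scalerA c) divff ?gt_eqF// scale1r.
  by rewrite scalerA mulVf ?scale1r// gt_eqF.
have t1' : 0 < 1 - t by rewrite subr_gt0.
split; split => //.
- by apply: (@summandE t x ((1 - t) *: x')) => //; apply: KZ => //; exact: ltW.
- apply: (@summandE (1 - t) x' (t *: x)) => //; last by rewrite addrC.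
  by apply: KZ => //; exact: ltW.
Qed.

(** * The dual cone as the cone over a box *)

Definition in_box (R : realType) (d : nat) (a b y : 'cV[R]_d) (l : R) : Prop :=
  forall i, l * b i 0 <= y i 0 <= l * a i 0.

Lemma in_box_ge0 (R : realType) (d : nat) (a b y : 'cV[R]_d) (l : R)
    (i : 'I_d) :
  b i 0 < a i 0 -> in_box a b y l -> 0 <= l.
Proof.
move=> ba /(_ i)/andP[lb la]; rewrite leNgt; apply/negP => l0.
by have := le_trans lb la; rewrite ler_nM2l// leNgt ba.
Qed.

Lemma ord_exists_neq (d : nat) (i : 'I_d) : (2 <= d)%N -> exists j, j != i.
Proof.
move=> d_ge2; exists (if i == Ordinal (ltnW d_ge2) then Ordinal d_ge2
                      else Ordinal (ltnW d_ge2)).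
by have [->|] := eqVneq i (Ordinal (ltnW d_ge2)); rewrite // eq_sym.
Qed.

Lemma dual_solvency_coneP (R : realType) (d : nat) (Pi : 'M[R]_d)
    (y : 'cV[R]_d) :
  dual_cone (solvency_cone Pi) y <->
  forall i j, y j 0 <= Pi i j * y i 0.
Proof.
have pairing i j :
    ((Pi i j *: delta_mx i 0 - delta_mx j 0 : 'cV[R]_d)^T *m y) 0 0
    = Pi i j * y i 0 - y j 0.
  by rewrite linearB /= linearZ /= !trmx_delta mulmxBl -scalemxAl -!rowE !mxE.
split.
  move=> Ky i j; rewrite -subr_ge0 -pairing; apply: Ky.
  exists (delta_mx i j); first by move=> k l; rewrite mxE ler0n.
  rewrite (bigD1 i)//= (bigD1 j)//= mxE !eqxx scale1r.
  rewrite big1 => [|l /negPf lj]; last by rewrite mxE lj andbF scale0r.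
  rewrite big1 => [|k /negPf ki]; first by rewrite !addr0.
  by rewrite big1 // => l _; rewrite mxE ki scale0r.
move=> ineq x [z z0 ->].
rewrite linear_sum /= mulmx_suml summxE sumr_ge0// => i _.
rewrite linear_sum /= mulmx_suml summxE sumr_ge0// => j _.
by rewrite linearZ /= -scalemxAl mxE pairing mulr_ge0// subr_ge0.
Qed.

(** The scale [l] is the least of the ratios [y_i / b_i]. *)
Lemma dual_transaction_coneP (R : realType) (d : nat) (a b y : 'cV[R]_d) :
  (2 <= d)%N -> (forall i : 'I_d, 0 < b i 0 < a i 0) ->
  dual_cone (solvency_cone (transaction_mx a b)) y <->
  exists l, in_box a b y l.
Proof.
move=> d_ge2 ab; rewrite dual_solvency_coneP.
have b0 i : 0 < b i 0 by case/andP: (ab i).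
have ba i : b i 0 < a i 0 by case/andP: (ab i).
have a0 i : 0 < a i 0 by exact: lt_trans (ba i).
split; last first.
  move=> [l lE] i j; rewrite mxE; case: eqP => [->|_]; first by rewrite mul1r.
  have /andP[_ /le_trans] := lE j; apply.
  have /andP[lb _] := lE i.
  by rewrite [l * _]mulrC -mulrA ler_pM2l// ler_pdivlMl// mulrC.
move=> ineq.
have cross i j : i != j -> b i 0 * y j 0 <= a j 0 * y i 0.
  move=> /negPf ij; have := ineq i j; rewrite mxE ij.
  by rewrite mulrAC ler_pdivlMr// mulrC.
(* chaining the inequalities for (i, j) and (j, i) gives
   [(a_i a_j - b_i b_j) y_i >= 0] *)
have y0 i : 0 <= y i 0.
  have [j ji] := ord_exists_neq i d_ge2.
  have ij : i != j by rewrite eq_sym.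
  have prod_gt0 : 0 < a i 0 * a j 0 - b i 0 * b j 0.
    by rewrite subr_gt0 ltr_pM// ?ltW.
  rewrite -(pmulr_rge0 _ prod_gt0) mulrBl subr_ge0 -!mulrA.
  apply: le_trans (_ : a i 0 * (b i 0 * y j 0) <= _).
    by rewrite [leRHS]mulrCA ler_pM2l//; exact: cross.
  by rewrite ler_pM2l//; exact: cross.
have := @arg_minP _ _ _ (Ordinal (ltnW d_ge2)) xpredT (fun i => y i 0 / b i 0).
case=> // i0 _ imin; exists (y i0 0 / b i0 0) => i; apply/andP; split.
  by rewrite -ler_pdivlMr// imin.
rewrite mulrAC ler_pdivlMr//.
have [->|i0i] := eqVneq i0 i; first by rewrite ler_wpM2l// ltW.
by rewrite mulrC [leRHS]mulrC cross.
Qed.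

Lemma dual_transaction_cone_pointed (R : realType) (d : nat)
    (a b : 'cV[R]_d) :
  (2 <= d)%N -> (forall i : 'I_d, 0 < b i 0 < a i 0) ->
  pointed_cone (dual_cone (solvency_cone (transaction_mx a b))).
Proof.
move=> d_ge2 ab; split.
- move=> c x c0 Kx z /Kx zx0; rewrite -scalemxAr mxE; exact: mulr_ge0.
- move=> x x' Kx Kx' z Kz; rewrite mulmxDr mxE.
  by rewrite addr_ge0//; [exact: Kx|exact: Kx'].
have ge0 x : dual_cone (solvency_cone (transaction_mx a b)) x ->
    forall i, 0 <= x i 0.
  move=> /(dual_transaction_coneP _ d_ge2 ab)[l lE] i.
  have /andP[b0 ba] := ab i; have /andP[lb _] := lE i.
  by apply: le_trans lb; rewrite mulr_ge0 ?(in_box_ge0 ba lE)// ltW.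
move=> x /ge0 x0 /ge0 xN0; apply/matrixP => i j; rewrite ord1 mxE.
by apply/eqP; rewrite eq_le x0 andbT; have := xN0 i; rewrite mxE oppr_ge0.
Qed.

(** * Vertices of the box *)

Definition box_vertex (R : realType) (d : nat) (a b : 'cV[R]_d)
    (P : {set 'I_d}) : 'cV[R]_d :=
  \col_i if i \in P then b i 0 else a i 0.

(** A coordinate in [P] bounds the scale from above and a coordinate outside [P]
    bounds it from below, so a vertex other than [a] and [b] determines its
    scale. *)
Lemma box_vertex_scale (R : realType) (d : nat) (a b : 'cV[R]_d)
    (P : {set 'I_d}) (c l : R) :
  (forall i : 'I_d, 0 < b i 0 < a i 0) ->
  P != finset.set0 -> P != finset.setT ->
  in_box a b (c *: box_vertex a b P) l -> l = c.
Proof.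
move=> ab /set0Pn[p pP]; rewrite -finset.subTset => /subsetPn[q _ qP] lE.
have /andP[bp0 _] := ab p; have /andP[bq0 baq] := ab q.
apply/eqP; rewrite eq_le; apply/andP; split.
  by have /andP[+ _] := lE p; rewrite !mxE pP ler_pM2r.
have /andP[_] := lE q; rewrite !mxE (negPf qP) ler_pM2r//.
exact: lt_trans baq.
Qed.

(** The scales of [u] and [v] add up to 1, which makes each inequality used for
    the sum an equality. *)
Lemma box_vertex_split (R : realType) (d : nat) (a b u v : 'cV[R]_d)
    (P : {set 'I_d}) (lu lv : R) :
  (forall i : 'I_d, 0 < b i 0 < a i 0) ->
  P != finset.set0 -> P != finset.setT ->
  in_box a b u lu -> in_box a b v lv -> box_vertex a b P = u + v ->
  u = lu *: box_vertex a b P.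
Proof.
move=> ab P0 PT uE vE uvE.
have l1 : lu + lv = 1.
  apply: (box_vertex_scale ab P0 PT) => i; rewrite scale1r uvE mxE !mulrDl.
  have /andP[ub ua] := uE i; have /andP[vb va] := vE i.
  by rewrite !lerD.
apply/matrixP => i j; rewrite ord1 !mxE.
have /andP[ub ua] := uE i; have /andP[vb va] := vE i.
have /matrixP/(_ i 0) := uvE; have lvE : lv = 1 - lu by lra.
subst lv; rewrite !mxE.
case: ifP => _ c; apply/eqP; rewrite eq_le; apply/andP; split => //; lra.
Qed.

Lemma box_vertex_inj (R : realType) (d : nat) (a b : 'cV[R]_d)
    (P P' : {set 'I_d}) (c : R) :
  (forall i : 'I_d, 0 < b i 0 < a i 0) ->
  P != finset.set0 -> P != finset.setT ->
  box_vertex a b P' = c *: box_vertex a b P -> P' = P.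
Proof.
move=> ab P0 PT E.
have ba i : b i 0 < a i 0 by case/andP: (ab i).
have c1 : 1 = c.
  apply: (box_vertex_scale ab P0 PT) => i; rewrite -E mxE !mul1r.
  by case: ifP; rewrite lexx ltW.
apply/setP => i; have /matrixP/(_ i 0) := E; rewrite -c1 !mxE mul1r.
case: ifP => _; case: ifP => // _ /eqP.
  by rewrite (lt_eqF (ba i)).
by rewrite (gt_eqF (ba i)).
Qed.

(** * Extreme directions of the dual cone *)

(** If the coordinate [k] could move both ways inside the box, then [y] would be
    the sum of the vectors [w e] and [w (- e)] below.  By extremality [w e] is
    proportional to [y]; a coordinate other than [k] shows that the ratio is
    [1/2], and the coordinate [k] contradicts this. *)
Lemma extreme_direction_coord (R : realType) (d : nat) (a b y : 'cV[R]_d)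
    (l : R) (k : 'I_d) :
  (2 <= d)%N -> (forall i : 'I_d, 0 < b i 0 < a i 0) ->
  extreme_direction (dual_cone (solvency_cone (transaction_mx a b))) y ->
  in_box a b y l -> y k 0 = l * b k 0 \/ y k 0 = l * a k 0.
Proof.
move=> d_ge2 ab ext lE.
have Kpt := dual_transaction_cone_pointed d_ge2 ab.
have /andP[lb la] := lE k; have /andP[_ ba] := ab k.
have [->|yb] := eqVneq (y k 0) (l * b k 0); [by left|right].
apply/eqP; apply/negPn/negP => ya.
have {}lb : l * b k 0 < y k 0 by rewrite lt_neqAle eq_sym yb.
have {}la : y k 0 < l * a k 0 by rewrite lt_neqAle ya.
have l0 : 0 < l.
  rewrite lt_neqAle (in_box_ge0 ba lE) andbT eq_sym; apply/eqP => l0.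
  by have := lt_trans lb la; rewrite l0 !mul0r ltxx.
have [j jk] := ord_exists_neq k d_ge2.
pose e := Order.min (y k 0 - l * b k 0) (l * a k 0 - y k 0).
have e0 : 0 < e by rewrite lt_min !subr_gt0 lb la.
have [eb ea] : e <= y k 0 - l * b k 0 /\ e <= l * a k 0 - y k 0.
  by split; rewrite ge_min lexx ?orbT.
pose w (s : R) : 'cV[R]_d := 2^-1 *: (y + s *: delta_mx k 0).
have Kw s : - e <= s <= e ->
    dual_cone (solvency_cone (transaction_mx a b)) (w s).
  move=> /andP[es se]; have [KZ _ _] := Kpt.
  apply: KZ; first by rewrite invr_ge0.
  apply/(dual_transaction_coneP _ d_ge2 ab); exists l => i.
  rewrite !mxE eqxx andbT.
  have [->|_] := eqVneq i k; last by rewrite mulr0 addr0 lE.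
  by rewrite mulr1; apply/andP; split; lra.
have [c cE] : exists c : R, w e = c *: y.
  apply: (extreme_direction_split Kpt ext (v := w (- e))).
  - by apply: Kw; lra.
  - by apply: Kw; lra.
  - apply/matrixP => i j'; rewrite !mxE; lra.
have yj0 : 0 < y j 0.
  have /andP[ljb _] := lE j; have /andP[b0 _] := ab j.
  by apply: lt_le_trans ljb; rewrite mulr_gt0.
have c2 : c = 2^-1.
  have /matrixP/(_ j 0) := cE; rewrite !mxE (negPf jk)/= mulr0 addr0.
  by move/(mulIf (lt0r_neq0 yj0)).
have /matrixP/(_ k 0) := cE; rewrite c2 !mxE !eqxx/= => E; lra.
Qed.

(** Boxes of nearby scales overlap: the vertex [b] is interior to the box of
    scale [r], and [a] is interior to the box of scale [1 / r]. *)
Lemma box_ratio (R : realType) (d : nat) (a b : 'cV[R]_d) :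
  (0 < d)%N -> (forall i : 'I_d, 0 < b i 0 < a i 0) ->
  exists2 r : R, 0 < r < 1 & forall i, b i 0 < r * a i 0.
Proof.
move=> d0 ab.
have := @arg_maxP _ _ _ (Ordinal d0) xpredT (fun i => b i 0 / a i 0).
case=> // i _ imax; set m := b i 0 / a i 0 in imax.
have [bi0 bai] := andP (ab i).
have m0 : 0 < m by rewrite divr_gt0// (lt_trans bi0).
have m1 : m < 1 by rewrite ltr_pdivrMr ?mul1r// (lt_trans bi0).
exists ((m + 1) / 2) => [|j]; first by lra.
have [bj0 baj] := andP (ab j).
rewrite -ltr_pdivrMr ?(lt_trans bj0)//.
by apply: le_lt_trans (imax j _) _ => //; lra.
Qed.

Lemma extreme_direction_vertexP (R : realType) (d : nat) (a b y : 'cV[R]_d) :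
  (2 <= d)%N -> (forall i : 'I_d, 0 < b i 0 < a i 0) ->
  extreme_direction (dual_cone (solvency_cone (transaction_mx a b))) y <->
  exists (P : {set 'I_d}) (l : R),
    [/\ P != finset.set0, P != finset.setT, 0 < l &
        y = l *: box_vertex a b P].
Proof.
move=> d_ge2 ab.
have b0 i : 0 < b i 0 by case/andP: (ab i).
have ba i : b i 0 < a i 0 by case/andP: (ab i).
have a0 i : 0 < a i 0 by exact: lt_trans (ba i).
pose i0 := Ordinal d_ge2.
have Kpt := dual_transaction_cone_pointed d_ge2 ab.
have [KZ _ _] := Kpt.
have boxP x := dual_transaction_coneP x d_ge2 ab.
split.
  move=> ext; have [/boxP[l lE] y0 _] := ext.
  have [r /andP[r0 r1] rE] := box_ratio (ltnW d_ge2) ab.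
  have l0 : 0 < l.
    rewrite lt_neqAle (in_box_ge0 (ba i0) lE) andbT eq_sym.
    apply: contra y0 => /eqP l0; apply/eqP/matrixP => i j; rewrite ord1 mxE.
    by have := lE i; rewrite l0 !mul0r -eq_le eq_sym => /eqP.
  pose P : {set 'I_d} := [set i | y i 0 == l * b i 0]%SET.
  have yE : y = l *: box_vertex a b P.
    apply/matrixP => i j; rewrite ord1 !mxE inE; case: eqP => // yb.
    by have [] := extreme_direction_coord i d_ge2 ab ext lE.
  have strict_absurd m :
      (forall i, m * b i 0 < y i 0) -> (forall i, y i 0 < m * a i 0) -> False.
    move=> mb ma; have mE : in_box a b y m by move=> i; rewrite !ltW.
    have [yi|yi] := extreme_direction_coord i0 d_ge2 ab ext mE.
      by have := mb i0; rewrite yi ltxx.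
    by have := ma i0; rewrite yi ltxx.
  exists P, l; split => //; apply/negP => /eqP PE.
  - apply: (strict_absurd (l / r)) => i; rewrite yE PE !mxE finset.in_set0.
      by rewrite -mulrA ltr_pM2l// mulrC ltr_pdivrMr// mulrC.
    by rewrite -mulrA ltr_pM2l// ltr_pdivlMl// gtr_pMl.
  - apply: (strict_absurd (l * r)) => i; rewrite yE PE !mxE finset.in_setT.
      by rewrite -mulrA ltr_pM2l// gtr_pMl.
    by rewrite -mulrA ltr_pM2l.
move=> [P [l [P0 PT l0 ->]]].
have vertex_box : in_box a b (box_vertex a b P) 1.
  by move=> i; rewrite !mxE !mul1r; case: ifP; rewrite lexx ltW.
apply: extreme_directionI => //.
- by apply: KZ; [exact: ltW|apply/boxP; exists 1].
- rewrite scaler_eq0 negb_or gt_eqF//=; apply/eqP => /matrixP/(_ i0 0).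
  by rewrite !mxE; case: ifP => _ /eqP; rewrite gt_eqF.
move=> u v Ku Kv uvE.
have liv0 : 0 <= l^-1 by rewrite invr_ge0 ltW.
have /boxP[lu luE] := KZ _ _ liv0 Ku.
have /boxP[lv lvE] := KZ _ _ liv0 Kv.
exists lu; have uE : l^-1 *: u = lu *: box_vertex a b P.
  apply: (box_vertex_split ab P0 PT luE lvE).
  by rewrite -scalerDr -uvE scalerA mulVf ?scale1r// gt_eqF.
by rewrite scalerA mulrC -scalerA -uE scalerA divff ?scale1r// gt_eqF.
Qed.

(** * Bipartitions and the correspondence *)

Lemma bipartitionsE (d : nat) (PN : {set 'I_d} * {set 'I_d}) :
  bipartitions PN <->
  [/\ PN.1 != finset.set0, PN.1 != finset.setT & PN.2 = finset.setC PN.1].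
Proof.
case: PN => P N; split => /= [[/= P0 N0 PN0 PNT]|[/= P0 PT ->]].
  have NE : N = finset.setC P.
    apply/setP => i; have /setP/(_ i) := PN0; have /setP/(_ i) := PNT.
    by rewrite !inE; case: (i \in P); case: (i \in N).
  by split => //; apply: contra N0 => /eqP PE; rewrite NE PE finset.setCT.
split => //=; last by rewrite finset.setUCr.
  apply: contra PT => /eqP PE.
  by rewrite -(finset.setCK P) PE finset.setC0.
by rewrite finset.setICr.
Qed.

Lemma bipartitions_card (d : nat) : (2 <= d)%N ->
  (@bipartitions d #= `I_(2 ^ d - 2)%N)%card.
Proof.
move=> d_ge2.
pose s := enum ([set: {set 'I_d}] :\ finset.set0 :\ finset.setT)%SET.
have s_uniq : uniq s by exact: enum_uniq.
have mem_s P : (P \in s) = (P != finset.set0) && (P != finset.setT).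
  by rewrite mem_enum !inE andbT andbC.
have setT_neq0 : finset.setT != finset.set0 :> {set 'I_d}.
  by apply/set0Pn; exists (Ordinal d_ge2); rewrite inE.
have s_size : size s = (2 ^ d - 2)%N.
  have := cardsD1 finset.set0 [set: {set 'I_d}]%SET.
  rewrite (cardsD1 finset.setT (_ :\ _)%SET) !inE setT_neq0 /= -cardE.
  rewrite -powersetT card_powerset cardsT card_ord addnA => ->.
  by rewrite addKn.
have -> : @bipartitions d =
    [set (nth finset.set0 s n, finset.setC (nth finset.set0 s n))
       | n in `I_(size s)].
  apply/seteqP; split => [[P N] /bipartitionsE[/= P0 PT ->]|_ [n /= n_lt <-]].
    have Ps : P \in s by rewrite mem_s P0.
    by exists (index P s); rewrite /= ?index_mem// nth_index.
  have := mem_nth finset.set0 n_lt; rewrite mem_s => /andP[n0 nT].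
  by apply/bipartitionsE; split.
rewrite -s_size; apply: inj_card_eq => m n; rewrite !inE /= => m_lt n_lt [mn _].
by apply/eqP; rewrite -(nth_uniq finset.set0 m_lt n_lt s_uniq) mn.
Qed.

Theorem corollary18 (R : realType) (d : nat) (a b : 'cV[R]_d)
    (d_ge2 : (2 <= d)%N) (ab : forall i : 'I_d, 0 < b i 0 < a i 0) :
  (exists f : {set 'I_d} * {set 'I_d} -> set 'cV[R]_d,
     set_bij (@bipartitions d)
       (extreme_directions (dual_cone (solvency_cone (transaction_mx a b)))) f
     /\ forall P N : {set 'I_d}, bipartitions (P, N) ->
          exists y : 'cV[R]_d,
            [/\ f (P, N) y,
                forall i, i \in P -> y i 0 = b i 0 &
                forall j, j \in N -> y j 0 = a j 0])
  /\ (extreme_directions (dual_cone (solvency_cone (transaction_mx a b)))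
       #= `I_(2 ^ d - 2)%N)%card.
Proof.
set K := dual_cone _.
have extP y : extreme_direction K y <-> _ :=
  extreme_direction_vertexP y d_ge2 ab.
pose ray (y : 'cV[R]_d) :=
  [set y' | extreme_direction K y' /\ exists2 c : R, 0 < c & y' = c *: y].
pose f (PN : {set 'I_d} * {set 'I_d}) := ray (box_vertex a b PN.1).
have vertex_ext (P : {set 'I_d}) : P != finset.set0 -> P != finset.setT ->
    extreme_direction K (box_vertex a b P).
  by move=> P0 PT; apply/extP; exists P, 1; rewrite scale1r.
have vertex_ray (P : {set 'I_d}) : P != finset.set0 -> P != finset.setT ->
    ray (box_vertex a b P) (box_vertex a b P).
  by move=> P0 PT; split; [exact: vertex_ext|exists 1; rewrite ?scale1r].
have f_bij : set_bij (@bipartitions d) (extreme_directions K) f.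
  split.
  - move=> PN /bipartitionsE[P0 PT _].
    by exists (box_vertex a b PN.1) => //; exact: vertex_ext.
  - move=> [P N] [P' N']; rewrite !inE => /bipartitionsE[/= P0 PT ->].
    move=> /bipartitionsE[/= P'0 P'T ->] ff.
    have : f (P, finset.setC P) (box_vertex a b P').
      by rewrite ff; exact: vertex_ray.
    by move=> [_ [c _ /(box_vertex_inj ab P0 PT) ->]].
  - move=> _ [y /[dup] yext /extP[P [l [P0 PT l0 yE]]] <-].
    exists (P, finset.setC P); first by apply/bipartitionsE.
    apply/seteqP; split => y' [y'ext [c c0 y'E]]; split => //.
      exists (c / l); first by rewrite divr_gt0.
      by rewrite yE scalerA divfK// gt_eqF.
    by exists (c * l); rewrite ?mulr_gt0// y'E yE scalerA.
split.
  exists f; split => // P N /bipartitionsE[/= P0 PT ->].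
  exists (box_vertex a b P); split; first exact: vertex_ray.
    by move=> i iP; rewrite mxE iP.
  by move=> i; rewrite inE => /negPf iP; rewrite mxE iP.
apply: card_eq_trans (bipartitions_card d_ge2).
have [f_fun f_inj f_surj] := f_bij.
have <- : f @` @bipartitions d = extreme_directions K.
  by apply/seteqP; split => // _ [PN PNb <-]; exact: f_fun.
exact: inj_card_eq.
Qed.
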